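(* Let $T\in M^n(\mathbb{C})$ be a normal matrix, let $P_T$ be the orthogonal projection onto $\mathcal{R}(T)$, let $T=U_T|T|$ be the polar decomposition of $T$, and put $V_2=P_T-T$ and $V=U_T-T$. Then the following assertions hold: (a) The proper splitting $T=P_T-V_2$ is convergent if and only if $\|P_T-T\|<1$. (b) If $T\in M^n_H(\mathbb{C})$, $P_T-|T|\in M^n_+(\mathbb{C})$ and $\|P_T-T\|<1$, then the proper splittings $T=P_T-V_2$ and $T=U_T-V$ are convergent and $\rho(U_T^*V)\leq\rho(V_2)<1$.
   Context: $M^n(\mathbb{C})$ denotes the complex $n\times n$ matrices, $M^n_H(\mathbb{C})$ the Hermitian ones and $M^n_+(\mathbb{C})$ the positive semidefinite ones; $\|\cdot\|$ is the spectral norm; $A^\dagger$ is the Moore-Penrose inverse; $\mathcal{R}(\cdot)$, $\mathcal{N}(\cdot)$, $\rho(\cdot)$ denote range, nullspace and spectral radius. The polar decomposition of $T$ is the unique factorization $T=U_T|T|$ with $|T|=(T^*T)^{1/2}$ and $U_T$ a partial isometry with $\mathcal{R}(U_T)=\mathcal{R}(T)$; it also satisfies $\mathcal{N}(U_T)=\mathcal{N}(T)$, and $U_T^\dagger=U_T^*$. A decomposition $T=U-V$ with $U,V\in M^{n}(\mathbb{C})$ is a proper splitting of $T$ if $\mathcal{R}(U)=\mathcal{R}(T)$ and $\mathcal{N}(U)=\mathcal{N}(T)$. The proper splitting $T=U-V$ is called convergent if $\rho(U^\dagger V)<1$. *)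

(* Defs.v *)
From HB Require Import structures.
From mathcomp Require Import all_boot all_order all_algebra.
From mathcomp Require Import all_classical all_reals.
From mathcomp Require Export complex.

Set Implicit Arguments.
Unset Strict Implicit.
Unset Printing Implicit Defensive.

Import Order.TTheory GRing.Theory Num.Theory.
Local Open Scope ring_scope.
Local Open Scope classical_set_scope.
Local Open Scope sesquilinear_scope.

Section MoorePenrose.
Context {C : numClosedFieldType} {n : nat}.
Implicit Types A X W : 'M[C]_n.

Definition is_mpinv A X : Prop :=
  [/\ A *m X *m A = A, X *m A *m X = X,
      (A *m X)^t* = A *m X & (X *m A)^t* = X *m A].

(* The default value 0 is never used: see mpinvP and mpinv_unique below. *)
Definition mpinv A : 'M[C]_n := xget 0 [set X | is_mpinv A X].

Let mulmx_adj m p q (A : 'M[C]_(m, p)) (B : 'M[C]_(p, q)) :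
  (A *m B)^t* = B^t* *m A^t*.
Proof. by rewrite trmx_mul map_mxM. Qed.

Let row_free_gram m p (F : 'M[C]_(m, p)) :
  row_free F -> F *m F^t* \in unitmx.
Proof.
move=> fF; rewrite -row_free_unit; apply: inj_row_free => v vFF.
have : dotmx (v *m F) (v *m F) = 0.
  by rewrite dotmxE mulmx_adj mulmxA -(mulmxA v) vFF mul0mx mxE.
by move/eqP; rewrite dnorm_eq0 => /eqP vF; apply: (row_free_inj fF); rewrite vF mul0mx.
Qed.

Lemma mpinv_unique A X W : is_mpinv A X -> is_mpinv A W -> X = W.
Proof.
move=> [a1 a2 a3 a4] [b1 b2 b3 b4].
have AXW : A *m X = A *m W.
  by rewrite -a3 -{1}b1 -(mulmxA (A *m W)) mulmx_adj a3 b3 !mulmxA a1.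
have XAW : X *m A = W *m A.
  by rewrite -a4 -{1}b1 -(mulmxA A) mulmxA mulmx_adj a4 b4 -!mulmxA (mulmxA A X) a1.
by rewrite -a2 XAW -mulmxA AXW mulmxA b2.
Qed.

Lemma mpinvP A : is_mpinv A (mpinv A).
Proof.
suff exX : exists X, is_mpinv A X.
  exact: (@xgetPex _ 0 [set X | is_mpinv A X] exX).
have := row_base_free A; have := col_base_full A; have := mulmx_base A.
move: (\rank A) (col_base A) (row_base A) => r B F <- fullB freeF {A}.
have uF : F *m F^t* \in unitmx by exact: row_free_gram.
have uB : B^t* *m B \in unitmx.
  have freeB : row_free (B^t* ) by rewrite /row_free mxrank_map mxrank_tr.
  by have := row_free_gram freeB; rewrite trmxCK.
pose G := invmx (F *m F^t* ); pose H := invmx (B^t* *m B).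
have GE : G^t* = G by rewrite /G trmx_inv map_invmx mulmx_adj trmxCK.
have HE : H^t* = H by rewrite /H trmx_inv map_invmx mulmx_adj trmxCK.
exists (F^t* *m G *m H *m B^t* ).
have BFX : B *m F *m (F^t* *m G *m H *m B^t* ) = B *m H *m B^t*.
  by rewrite !mulmxA -(mulmxA B F) -(mulmxA B _ G) mulmxV// mulmx1.
have XBF : F^t* *m G *m H *m B^t* *m (B *m F) = F^t* *m G *m F.
  by rewrite !mulmxA -(mulmxA _ _ B) -(mulmxA _ H) mulVmx// mulmx1.
split.
- by rewrite BFX !mulmxA -(mulmxA _ _ B) -(mulmxA _ H) mulVmx// mulmx1.
- by rewrite XBF !mulmxA -(mulmxA _ F) -(mulmxA _ (F *m _)) mulmxV// mulmx1.
- by rewrite BFX !mulmx_adj trmxCK HE mulmxA.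
- by rewrite XBF !mulmx_adj trmxCK GE mulmxA.
Qed.

End MoorePenrose.

Section MatrixAnalysis.
Context {R : realType} {n : nat}.
Local Notation C := (complex R).
Implicit Types (A P T U V : 'M[C]_n) (x y : 'cV[C]_n).

(* Matrices act on column vectors; this is the column space of A, while the
   library's row-space operations are about row vectors. *)
Definition mxrange A : set 'cV[C]_n := range (fun x : 'cV[C]_n => A *m x).

Definition mxnull A : set 'cV[C]_n := [set x | A *m x = 0].

Definition cdot x y : C := (x^t* *m y) 0 0.

Definition l2norm x : R := Num.sqrt (\sum_(i < n) Normc.normc (x i 0) ^+ 2).

Definition spectral_norm A : R :=
  sup [set l2norm (A *m x) | x in [set x | l2norm x <= 1]].

(* For n = 0 there is no eigenvalue and the value is sup set0 = 0. *)
Definition spectral_radius A : R :=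
  sup [set Normc.normc a | a in [set a : C | eigenvalue A a]].

(* The order of C makes 0 <= z mean that z is real and nonnegative. *)
Definition psdmx A : Prop :=
  A \is hermsymmx /\ forall x, 0 <= cdot x (A *m x).

Definition is_orth_proj_onto (S : set 'cV[C]_n) P : Prop :=
  [/\ P *m P = P, P^t* = P & mxrange P = S].

Definition is_mxabs T A : Prop := psdmx A /\ A *m A = T^t* *m T.

(* U is isometric on the orthogonal complement of its null space. *)
Definition partial_isometry U : Prop :=
  forall x, (forall y, mxnull U y -> cdot y x = 0) ->
  l2norm (U *m x) = l2norm x.

Definition polar_decomposition T U A : Prop :=
  [/\ is_mxabs T A, partial_isometry U, mxrange U = mxrange T & T = U *m A].

Definition proper_splitting T U V : Prop :=
  [/\ T = U - V, mxrange U = mxrange T & mxnull U = mxnull T].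

Definition convergent_proper_splitting T U V : Prop :=
  proper_splitting T U V /\ spectral_radius (mpinv U *m V) < 1.

End MatrixAnalysis.

(* Main.v *)
(* Since T is normal, T P = P T = T, so P - T is normal, and unitary
   diagonalization identifies its spectral norm with its spectral radius; as
   P is its own Moore-Penrose inverse, this is (a). For (b), a nonzero
   eigenvalue a of the Hermitian T gives the eigenvalue 1 - a of P - T, and
   |1 - a| < 1 forces a > 0. Hence T is positive semidefinite, |T| = T by
   uniqueness of the positive square root, and U = P, so the two splittings
   coincide. *)
Require Import Defs.
From mathcomp Require Import all_boot all_order all_algebra.
From mathcomp Require Import all_classical all_reals.
Import Order.TTheory GRing.Theory Num.Theory.
Local Open Scope ring_scope.
Local Open Scope sesquilinear_scope.

Section NormalMatrices.
Set Implicit Arguments.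
Unset Strict Implicit.
Context {R : realType}.
Local Notation C := (complex R).

(** * Adjoints, inner product and Euclidean norm *)

Lemma adjmxM m n p (A : 'M[C]_(m, n)) (B : 'M[C]_(n, p)) :
  (A *m B)^t* = B^t* *m A^t*.
Proof. by rewrite trmx_mul map_mxM. Qed.

Lemma adjmxB m n (A B : 'M[C]_(m, n)) : (A - B)^t* = A^t* - B^t*.
Proof. by rewrite raddfB /= map_mxB. Qed.

Lemma hermsymmx_adj n (A : 'M[C]_n) : (A \is hermsymmx) = (A^t* == A).
Proof. by rewrite qualifE /= expr0 scale1r eq_sym. Qed.

Lemma normc_ge0 (a : C) : 0 <= Normc.normc a.
Proof. by case: a => re im; exact: sqrtr_ge0. Qed.

Context {n : nat}.
Implicit Types (A B N P Q T U : 'M[C]_n) (x y : 'cV[C]_n).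

Lemma eq_mulmx_col A B : (forall x, A *m x = B *m x) -> A = B.
Proof.
move=> AB; apply/matrixP => i j.
by have /colP/(_ i) := AB (delta_mx j 0); rewrite -!colE !mxE.
Qed.

(** Links the real-valued norm to the complex inner product, so that norm identities follow by
    moving adjoints across [cdot]. *)
Lemma sqr_l2norm x : cdot x x = (l2norm x ^+ 2)%:C%C.
Proof.
rewrite /l2norm sqr_sqrtr; last by apply: sumr_ge0 => i _; exact: sqr_ge0.
rewrite /cdot mxE rmorph_sum; apply: eq_bigr => i _.
by rewrite !mxE mulrC -normCK rmorphXn.
Qed.

Lemma eq_l2norm x y : cdot x x = cdot y y -> l2norm x = l2norm y.
Proof.
rewrite !sqr_l2norm => /complexI /eqP.
by rewrite eqrXn2 ?sqrtr_ge0// => /eqP.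
Qed.

Lemma cdot_eq0 x : cdot x x = 0 -> x = 0.
Proof.
rewrite /cdot mxE => /eqP; rewrite psumr_eq0; last first.
  by move=> i _; rewrite !mxE mulrC mul_conjC_ge0.
move=> /allP x0; apply/colP => i; rewrite [RHS]mxE.
have := x0 i (mem_index_enum i).
by rewrite !mxE mulrC mul_conjC_eq0 => /eqP.
Qed.

Lemma cdot_mulr A x y : cdot x (A *m y) = cdot (A^t* *m x) y.
Proof. by rewrite /cdot adjmxM trmxCK mulmxA. Qed.

Lemma cdotBl x y z : cdot (x - y) z = cdot x z - cdot y z.
Proof. by rewrite /cdot adjmxB mulmxBl mxE [X in _ + X]mxE. Qed.

Lemma gram_eq0 A : A^t* *m A = 0 -> A = 0.
Proof.
move=> AA0; apply: eq_mulmx_col => x; rewrite mul0mx.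
by apply: cdot_eq0; rewrite cdot_mulr mulmxA AA0 mul0mx /cdot trmx0 map_mx0 mul0mx mxE.
Qed.

Lemma l2norm_unitary Q x : Q \is unitarymx -> l2norm (Q *m x) = l2norm x.
Proof.
rewrite -trmxC_unitary => /unitarymxP; rewrite trmxCK => QQ.
by apply: eq_l2norm; rewrite cdot_mulr mulmxA QQ mul1mx.
Qed.

(** * Spectral theory of normal and Hermitian matrices *)

Lemma normal_spectralE N : N \is normalmx ->
  N = (spectralmx N)^t* *m diag_mx (spectral_diag N) *m spectralmx N.
Proof.
by move=> /orthomx_spectralP {1}->; rewrite invmx_unitary ?spectral_unitarymx.
Qed.

(** [eigenvalue] is about row vectors, so the eigenvectors at hand are the rows of the unitary
    factor. *)
Lemma spectral_row N i : N \is normalmx ->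
  row i (spectralmx N) *m N = spectral_diag N 0 i *: row i (spectralmx N).
Proof.
move=> Nn; have /unitarymxP QQ := spectral_unitarymx N.
rewrite -row_mul {2}(normal_spectralE Nn) !mulmxA QQ mul1mx.
by rewrite row_mul row_diag_mx -scalemxAl -rowE.
Qed.

Lemma row_spectralmx_neq0 N i : row i (spectralmx N) != 0.
Proof.
apply/eqP => q0; have := row_unitarymxP (spectral_unitarymx N) i i.
by rewrite q0 linear0l eqxx => /eqP; rewrite eq_sym oner_eq0.
Qed.

(** In the coordinates [w = v Q^t*] an eigenvector satisfies [w D = a w]; any nonzero coordinate of
    [w] singles out the diagonal entry equal to [a]. *)
Lemma eigenvalue_spectralP N a : N \is normalmx ->
  (eigenvalue N a <-> exists i, a = spectral_diag N 0 i).
Proof.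
move=> Nn; split=> [/eigenvalueP [v vN v0]|[i ->]]; last first.
  apply/eigenvalueP; exists (row i (spectralmx N)); first exact: spectral_row.
  exact: row_spectralmx_neq0.
have := normal_spectralE Nn; have := spectral_unitarymx N.
move: (spectralmx N) (spectral_diag N) => Q d uQ NE.
pose w := v *m Q^t*; have vE : v = w *m Q by rewrite mulmxKtV.
have wD : w *m diag_mx d = a *: w by rewrite /w scalemxAl -vN NE !mulmxA mulmxtVK.
have [i wi] : exists i, w 0 i != 0.
  by apply/rV0Pn; apply: contra_neq v0 => w0; rewrite vE w0 mul0mx.
exists i; apply: (mulfI wi).
by have /rowP /(_ i) := wD; rewrite mul_mx_diag [LHS]mxE [RHS]mxE [RHS]mulrC => ->.
Qed.

Lemma sup_max (E : set R) m : E m -> ubound E m -> sup E = m.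
Proof.
move=> Em mE; apply/le_anti; rewrite ge_sup//=; last by exists m.
by apply: ub_le_sup => //; exists m.
Qed.

Lemma l2normZ a x : l2norm (a *: x) = Normc.normc a * l2norm x.
Proof.
rewrite /l2norm -[Normc.normc a]ger0_norm ?normc_ge0// -sqrtr_sqr.
rewrite -sqrtrM ?sqr_ge0// mulr_sumr; congr Num.sqrt; apply: eq_bigr => i _.
by rewrite mxE Normc.normcM exprMn.
Qed.

Lemma l2norm_delta i : l2norm (delta_mx i 0 : 'cV[C]_n) = 1.
Proof.
rewrite /l2norm (bigD1 i)//= big1 => [|j ji]; last first.
  by rewrite mxE (negbTE ji) Normc.normc0 expr0n.
by rewrite mxE !eqxx Normc.normc1 expr1n addr0 sqrtr1.
Qed.

(** The unitary factors preserve the norm, which leaves a diagonal matrix; there the squared norms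
    compare coordinate by coordinate. *)
Lemma normal_l2norm_le N (m : R) : N \is normalmx -> 0 <= m ->
  (forall i, Normc.normc (spectral_diag N 0 i) <= m) ->
  forall x, l2norm (N *m x) <= m * l2norm x.
Proof.
move=> Nn m0 dm x; rewrite {1}(normal_spectralE Nn) -!mulmxA.
rewrite l2norm_unitary ?trmxC_unitary ?spectral_unitarymx//.
rewrite -(l2norm_unitary x (spectral_unitarymx N)).
move: (_ *m x) => y.
rewrite -(@ler_pXn2r _ 2) ?nnegrE ?mulr_ge0 ?sqrtr_ge0//.
rewrite exprMn /l2norm !sqr_sqrtr; try by apply: sumr_ge0 => i _; exact: sqr_ge0.
rewrite mulr_sumr; apply: ler_sum => i _.
rewrite mul_diag_mx mxE Normc.normcM exprMn ler_wpM2r ?sqr_ge0//.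
by rewrite ler_pXn2r ?nnegrE ?normc_ge0.
Qed.

(** This column is a unit eigenvector; at the entry of largest modulus it shows that the bound of
    [normal_l2norm_le] is attained. *)
Lemma l2norm_spectral N i : N \is normalmx ->
  let x := (spectralmx N)^t* *m delta_mx i 0 in
  l2norm x = 1 /\ l2norm (N *m x) = Normc.normc (spectral_diag N 0 i).
Proof.
move=> Nn /=; have := normal_spectralE Nn; have := spectral_unitarymx N.
move: (spectralmx N) (spectral_diag N) => Q d uQ NE.
have x1 : l2norm (Q^t* *m delta_mx i 0) = 1.
  by rewrite l2norm_unitary ?trmxC_unitary// l2norm_delta.
split=> //; rewrite NE mulmxA mulmxtVK// -mulmxA.
have -> : diag_mx d *m delta_mx i 0 = d 0 i *: delta_mx i 0 :> 'cV[C]_n.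
  apply/colP => j; rewrite mul_diag_mx !mxE.
  by case: (eqVneq j i) => [->//|_]; rewrite !mulr0.
by rewrite -scalemxAr l2normZ x1 mulr1.
Qed.

Lemma normal_spectral_norm N : N \is normalmx ->
  spectral_norm N = spectral_radius N.
Proof.
(* Choosing a diagonal entry of maximal modulus needs an index, so [n = 0] is treated apart: one
   supremum is over the singleton 0, the other is [sup set0], and both are 0. *)
move=> Nn; have [n0|n_gt0] := posnP n.
  have no_ord (i : 'I_n) : False by case: i => k; rewrite n0.
  have l0 x : l2norm x = 0 by rewrite /l2norm big1 ?sqrtr0// => i; case: (no_ord i).
  transitivity (0 : R); last symmetry.
    by apply: sup_max => [|_ [x _ <-]]; [exists 0; rewrite /= l0 | rewrite l0].
  rewrite /spectral_radius (_ : image _ _ = set0) ?sup0//.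
  apply/seteqP; split=> // _ [a /= aN _].
  have [i _] := (eigenvalue_spectralP a Nn).1 aN; case: (no_ord i).
pose m i := Normc.normc (spectral_diag N 0 i).
case: (@Order.TotalTheory.arg_maxP _ R _ (Ordinal n_gt0) predT m) => // i _ mi.
transitivity (m i); last symmetry; apply: sup_max.
- have [x1 Nx] := l2norm_spectral i Nn.
  by exists ((spectralmx N)^t* *m delta_mx i 0) => //=; rewrite x1.
- move=> _ [x x1 <-]; apply: le_trans (ler_piMr (normc_ge0 _) x1).
  by apply: normal_l2norm_le => // [|j]; [exact: normc_ge0 | exact: mi].
- by exists (spectral_diag N 0 i) => //; apply/(eigenvalue_spectralP _ Nn); exists i.
- by move=> _ [a /= aN <-]; have [j ->] := (eigenvalue_spectralP a Nn).1 aN; exact: mi.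
Qed.

Lemma normc_eigenvalue_le N a : N \is normalmx -> eigenvalue N a ->
  Normc.normc a <= spectral_radius N.
Proof.
move=> Nn aN; apply: ub_le_sup; last by exists a.
(* A crude bound suffices: [ub_le_sup] only asks that the set be bounded above. *)
exists (\sum_i Normc.normc (spectral_diag N 0 i)).
move=> _ [b /= bN <-]; have [i ->] := (eigenvalue_spectralP b Nn).1 bN.
by rewrite (bigD1 i)//= lerDl sumr_ge0// => j _; exact: normc_ge0.
Qed.

(* With X = A - B, A X + X B = 0; testing this on an eigenvector v of X for l
   gives l (<v, A v> + <v, B v>) = 0, whence l = 0 in either case. *)
Lemma eq_psd_sqr A B : psdmx A -> psdmx B -> A *m A = B *m B -> A = B.
Proof.
move=> [Ah A0] [Bh B0] AABB.
have Xh : A - B \is hermsymmx.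
  by move: Ah Bh; rewrite !hermsymmx_adj adjmxB => /eqP -> /eqP ->.
have Xn := hermitian_normalmx Xh.
have XE : A *m (A - B) + (A - B) *m B = 0.
  by rewrite mulmxBr mulmxBl AABB addrC subrKA subrr.
suff d0 i : spectral_diag (A - B) 0 i = 0.
  apply/eqP; rewrite -subr_eq0 (normal_spectralE Xn).
  have -> : spectral_diag (A - B) = 0 by apply/rowP => i; rewrite d0 mxE.
  by rewrite raddf0 mulmx0 mul0mx.
set l := spectral_diag _ 0 i; set v := row i (spectralmx (A - B)).
have vX : v *m (A - B) = l *: v by exact: spectral_row.
(* As [l] is real, taking adjoints turns the row eigenvector [v] into a column eigenvector for the
   same [l]. *)
have lreal : l^* = l.
  by apply/CrealP; have /mxOverP := hermitian_spectral_diag_real Xh; exact.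
have Xv : (A - B) *m v^t* = l *: v^t*.
  move/(congr1 (fun w : 'rV_n => w^t*)): vX.
  rewrite adjmxM; move: Xh; rewrite hermsymmx_adj => /eqP ->.
  by rewrite linearZ /= map_mxZ => ->; congr (_ *: _); exact: lreal.
have v0 : v^t* != 0.
  apply: contraNneq (row_spectralmx_neq0 (A - B) i) => v0.
  by rewrite -/v -(trmxCK v) v0 trmx0 map_mx0.
have cE M : cdot (v^t* ) (M *m v^t*) = (v *m M *m v^t*) 0 0.
  by rewrite /cdot trmxCK mulmxA.
have : (v *m (A *m (A - B) + (A - B) *m B) *m v^t*) 0 0 = 0.
  by rewrite XE mulmx0 mul0mx mxE.
rewrite mulmxDr mulmxDl !mulmxA vX -[_ *m (A - B) *m _]mulmxA Xv.
rewrite -!scalemxAl -scalemxAr -scalerDr mxE => /eqP; rewrite mulf_eq0.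
(* If [l] is nonzero, two nonnegative terms sum to 0, so both vanish; their difference is [l] times
   the squared norm of [v]. *)
case/orP => [/eqP //|]; rewrite mxE -!cE paddr_eq0 ?A0 ?B0// => /andP[/eqP Av /eqP Bv].
have : cdot (v^t* ) ((A - B) *m v^t*) = 0.
  by rewrite cE mulmxBr mulmxBl mxE [X in _ + X]mxE -!cE Av Bv subr0.
rewrite Xv /cdot -scalemxAr mxE => /eqP; rewrite mulf_eq0 => /orP[/eqP //|/eqP vv].
by rewrite (cdot_eq0 vv) eqxx in v0.
Qed.

(** In the eigenbasis the quadratic form is the sum of the eigenvalues weighted by squared moduli of
    coordinates. *)
Lemma hermitian_psd T : T \is hermsymmx ->
  (forall a, eigenvalue T a -> 0 <= a) -> psdmx T.
Proof.
move=> Th ev_ge0; split=> // x.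
have Tn := hermitian_normalmx Th.
have d0 i : 0 <= spectral_diag T 0 i.
  by apply: ev_ge0; apply/(eigenvalue_spectralP _ Tn); exists i.
have := normal_spectralE Tn.
move: (spectralmx T) (spectral_diag T) d0 => Q d d0 ->.
rewrite -!mulmxA cdot_mulr trmxCK /cdot mul_diag_mx mxE.
apply: sumr_ge0 => i _; rewrite !mxE mulrCA mulr_ge0//.
by rewrite mulrC mul_conjC_ge0.
Qed.

(** * The orthogonal projection onto the range of a normal matrix *)

Section RangeProjection.
Variables (T P : 'M[C]_n).
Hypothesis Pproj : is_orth_proj_onto (mxrange T) P.

Lemma orth_proj_id U : mxrange U = mxrange T -> P *m U = U.
Proof.
case: Pproj => PP _ PT UT; apply: eq_mulmx_col => x.
have : mxrange P (U *m x) by rewrite PT -UT; exists x.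
by rewrite -mulmxA; case=> z _ <-; rewrite mulmxA PP.
Qed.

Lemma orth_proj_range_sub U : mxrange U = mxrange T ->
  forall x, exists z, P *m x = U *m z.
Proof.
case: Pproj => _ _ PT UT x.
have : mxrange U (P *m x) by rewrite UT -PT; exists x.
by case=> z _ <-; exists z.
Qed.

Lemma mpinv_orth_proj : mpinv P = P.
Proof.
case: Pproj => PP Ph _; apply: (mpinv_unique (mpinvP P)).
by split; rewrite !PP ?Ph.
Qed.

Hypothesis Tnormal : T \is normalmx.

(** [P] fixes the range of [T], hence [P T = T] and [T^t* P = T^t*]. Normality replaces [T^t* T] by
    [T T^t*], which absorbs [P] on both sides, so the Gram matrix of [T - T P] cancels. *)
Lemma normal_mul_orth_proj : T *m P = T.
Proof.
have [_ Ph _] := Pproj; have PT := orth_proj_id (erefl (mxrange T)).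
have TP : T^t* *m P = T^t* by rewrite -{1}Ph -adjmxM PT.
apply/esym/eqP; rewrite -subr_eq0; apply/eqP/gram_eq0.
rewrite adjmxB adjmxM Ph mulmxBr !mulmxBl.
rewrite -!mulmxA (mulmxA _ T P) -(normalmxP Tnormal).
rewrite -(mulmxA T _ P) TP (mulmxA P T) PT !subrr.
by [].
Qed.

(** For the harder inclusion, normality turns [T x = 0] into [T^t* x = 0]; with [P x = T z], the
    squared norm of [P x] is [<T^t* P x, z> = <T^t* x, z> = 0]. *)
Lemma normal_orth_proj_null : mxnull P = mxnull T.
Proof.
have [_ Ph _] := Pproj; apply/seteqP; split=> x; rewrite /mxnull /= => x0.
  by rewrite -normal_mul_orth_proj -mulmxA x0 mulmx0.
apply: cdot_eq0; have [z Pz] := orth_proj_range_sub (erefl (mxrange T)) x.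
have Tx : T^t* *m x = 0.
  apply: cdot_eq0; rewrite cdot_mulr trmxCK mulmxA (normalmxP Tnormal) -mulmxA x0.
  by rewrite mulmx0 /cdot trmx0 map_mx0 mul0mx mxE.
rewrite Pz cdot_mulr -Pz mulmxA -{1}Ph -adjmxM.
rewrite (orth_proj_id (erefl (mxrange T))) Tx.
by rewrite /cdot trmx0 map_mx0 mul0mx mxE.
Qed.

Lemma orth_proj_proper_splitting : proper_splitting T P (P - T).
Proof.
have [_ _ PT] := Pproj; split=> //; first by rewrite subKr.
exact: normal_orth_proj_null.
Qed.

(** [P] acts as the identity on both sides of [T] and of [T^t*], so both products reduce to
    [P - T - T^t* + T T^t*]. *)
Lemma orth_proj_sub_normal : P - T \is normalmx.
Proof.
have [PP Ph _] := Pproj; have PT := orth_proj_id (erefl (mxrange T)).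
have TP := normal_mul_orth_proj.
have TaP : T^t* *m P = T^t* by rewrite -{1}Ph -adjmxM PT.
have PTa : P *m T^t* = T^t* by rewrite -{1}Ph -adjmxM TP.
apply/normalmxP; rewrite adjmxB Ph !mulmxBr !mulmxBl PP TP PT TaP PTa.
rewrite (normalmxP Tnormal) !opprB !addrA.
by rewrite [LHS]addrAC [P - T - _]addrAC [RHS]addrAC.
Qed.

Lemma orth_proj_convergent : convergent_proper_splitting T P (P - T) <->
  spectral_norm (P - T) < 1.
Proof.
have [PP _ _] := Pproj.
have PV : mpinv P *m (P - T) = P - T.
  by rewrite mpinv_orth_proj mulmxBr PP (orth_proj_id (erefl (mxrange T))).
rewrite (normal_spectral_norm orth_proj_sub_normal) /convergent_proper_splitting PV.
by split=> [[]//|?]; split=> //; exact: orth_proj_proper_splitting.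
Qed.

Lemma hermitian_psd_of_norm_lt1 : T \is hermsymmx ->
  spectral_norm (P - T) < 1 -> psdmx T.
Proof.
move=> Th; rewrite (normal_spectral_norm orth_proj_sub_normal) => lt1.
apply: hermitian_psd => // a aT; have [->//|a0] := eqVneq a 0.
have areal : a \is Num.real.
  have [i ->] := (eigenvalue_spectralP a Tnormal).1 aT.
  by have /mxOverP := hermitian_spectral_diag_real Th; exact.
have : eigenvalue (P - T) (1 - a).
  have /eigenvalueP [v vT v0] := aT; apply/eigenvalueP; exists v => //.
  (* From [a v = v T = v T P = a v P], cancelling the nonzero [a]. *)
  have vP : v *m P = v.
    apply: (scalerI a0); rewrite scalemxAl -vT -mulmxA.
    by rewrite normal_mul_orth_proj.
  by rewrite mulmxBr vP vT scalerBl scale1r.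
move=> /(normc_eigenvalue_le orth_proj_sub_normal) /le_lt_trans /(_ lt1).
rewrite -ltcR => a1; have {a1} : `|1 - a| < 1 by exact: a1.
(* For real [a] the bound reads [0 < a < 2]. *)
by rewrite distrC real_ltr_distl ?rpredB ?rpred1// subrr => /andP[/ltW].
Qed.

(* The orthogonal projection onto the orthocomplement of the null space of U
   is [mpinv U *m U]; U fixes every y in the range of P, so isometry forces that
   projection to preserve the norm of y, hence to fix y. *)
Lemma partial_isometry_fix U : partial_isometry U ->
  mxrange U = mxrange T -> U *m P = P -> U = P.
Proof.
move=> Uiso UT UP; have [PP Ph _] := Pproj; have PU := orth_proj_id UT.
have [UG GU _ Gh] := mpinvP U; set G := mpinv U *m U in Gh.
have {}UG : U *m G = U by rewrite /G mulmxA.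
have GG : G *m G = G by rewrite /G mulmxA GU.
have UU : U *m U = U by rewrite -{2}PU mulmxA UP.
have {}GU : G *m U = G by rewrite /G -mulmxA UU.
have GUx y : U *m y = 0 -> G *m y = 0 by rewrite /G -mulmxA => ->; rewrite mulmx0.
clearbody G.
(* [G P x] is orthogonal to the null space of [U], and [U] sends it to [U P x = P x]. *)
have Giso x : l2norm (G *m (P *m x)) = l2norm (P *m x).
  rewrite -(Uiso (G *m _)) => [|y Uy]; first by rewrite (mulmxA U) UG mulmxA UP.
  rewrite cdot_mulr Gh GUx//.
  by rewrite /cdot trmx0 map_mx0 mul0mx mxE.
have GP : G *m P = P.
  apply: eq_mulmx_col => x; have := Giso x; rewrite -mulmxA.
  move: (P *m x) => y /(congr1 (fun r => (r ^+ 2)%:C%C)); rewrite -!sqr_l2norm.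
  rewrite cdot_mulr Gh mulmxA GG => Gyy.
  apply/esym/eqP; rewrite -subr_eq0; apply/eqP/cdot_eq0.
  (* [1 - G] is an orthogonal projection too, so the squared norm of [y - G y] is
     [<y, y> - <G y, y>], which is 0. *)
  have -> : y - G *m y = (1%:M - G) *m y by rewrite mulmxBl mul1mx.
  rewrite cdot_mulr adjmxB Gh trmx1 map_mx1 mulmxA mulmxBr mulmx1.
  by rewrite [_ *m G]mulmxBl mul1mx GG subrr subr0 mulmxBl mul1mx cdotBl Gyy subrr.
(* The adjoint of [G P = P]; then [U = P U = P G U = P G = P]. *)
have PG : P *m G = P by rewrite -{1}Ph -Gh -adjmxM GP Ph.
by rewrite -PU -{1}PG -mulmxA GU PG.
Qed.

End RangeProjection.

End NormalMatrices.

Theorem proposition7p6 (R : realType) (n : nat) (T P U A : 'M[complex R]_n)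
  (T_normal : T \is normalmx)
  (P_proj : is_orth_proj_onto (mxrange T) P)
  (T_polar : polar_decomposition T U A) :
  let V2 := P - T in
  let V := U - T in
  (proper_splitting T P V2 /\
   (convergent_proper_splitting T P V2 <-> spectral_norm (P - T) < 1)) /\
  (T \is hermsymmx -> psdmx (P - A) -> spectral_norm (P - T) < 1 ->
   [/\ convergent_proper_splitting T P V2,
       convergent_proper_splitting T U V,
       spectral_radius (U^t* *m V) <= spectral_radius V2 &
       spectral_radius V2 < 1]).
Proof.
move=> V2 V; split.
  split; first exact: orth_proj_proper_splitting.
  exact: orth_proj_convergent.
move=> Th _ lt1; have cP := (orth_proj_convergent P_proj T_normal).2 lt1.
have [[Apsd AA] Uiso UT TUA] := T_polar.
have AT : A = T.
  apply: eq_psd_sqr Apsd (hermitian_psd_of_norm_lt1 P_proj T_normal Th lt1) _.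
  by rewrite AA; move: Th; rewrite hermsymmx_adj => /eqP ->.
have UP : U = P.
  (* [T = U A = U T] says that [U] fixes the range of [T], which is that of [P]. *)
  apply: (partial_isometry_fix P_proj) => //; apply: eq_mulmx_col => x.
  have [z Pz] := orth_proj_range_sub P_proj (erefl (mxrange T)) x.
  by rewrite -mulmxA Pz mulmxA; congr (_ *m z); rewrite [RHS]TUA AT.
have [PP Ph _] := P_proj.
(* With [U = P], the matrix [U^t* V] becomes [P (P - T) = P - T], so the two spectral radii are
   equal. *)
rewrite /V UP Ph mulmxBr PP (orth_proj_id P_proj (erefl _)).
split=> //; rewrite /V2 -normal_spectral_norm//.
exact: orth_proj_sub_normal.
Qed.
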